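(* $$\sup_{r\ge 3,\;\rho\in(0,1),\;\gamma\in(0,1)}\mu\big(r,\rho,\gamma A+(1-\gamma)B\big)=1,$$ where the supremum is over all integers $r\ge 3$ and all real $\rho\in(0,1)$ and $\gamma\in(0,1)$, and $\mu(r,\rho,\gamma A+(1-\gamma)B)$ is the rate of profit of the random mixture of Parrondo games $A$ and $B$ defined in the context.
   Context: A $p$-coin is a coin with probability $p$ of heads. A player has an integer-valued capital; in each game the player wins one unit with heads and loses one unit with tails. In game $A$ a fair coin is tossed. Game $B$ has parameters an integer $r\ge 3$ and a real $\rho\in(0,1)$: a $p_0$-coin is tossed if the current capital is a multiple of $r$, and a $p_1$-coin is tossed otherwise, where $$p_0=\frac{\rho^{r-1}}{1+\rho^{r-1}},\qquad p_1=\frac{1}{1+\rho}$$ (this is the parametrization of the fairness constraint $(1-p_0)(1-p_1)^{r-1}=p_0\,p_1^{r-1}$ with $p_0<\frac12<p_1$). The random mixture $\gamma A+(1-\gamma)B$, $\gamma\in(0,1)$, means that at each turn, independently, game $A$ is played with probability $\gamma$ and game $B$ is played otherwise. Equivalently, capital is a nearest-neighbor Markov chain on $\mathbb{Z}$ which moves from $x$ to $x+1$ with probability $\frac{\gamma}{2}+(1-\gamma)p_0$ if $r\mid x$ and $\frac{\gamma}{2}+(1-\gamma)p_1$ if $r\nmid x$, and otherwise moves to $x-1$. If $S_n$ denotes the cumulative profit (current capital minus initial capital) after $n$ turns, the rate of profit $\mu(r,\rho,\gamma A+(1-\gamma)B)$ is the constant to which $n^{-1}S_n$ converges almost surely as $n\to\infty$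 (this constant does not depend on the initial capital). *)

(* Defs.v *)
From HB Require Import structures.
From mathcomp Require Import all_boot all_order all_algebra.
From mathcomp Require Import all_classical all_reals all_analysis.
Set Implicit Arguments.
Unset Strict Implicit.
Unset Printing Implicit Defensive.
Import Order.TTheory GRing.Theory Num.Theory.
Import numFieldNormedType.Exports.
Local Open Scope classical_set_scope.
Local Open Scope ring_scope.

(* With this parametrization, (1 - p0) (1 - p1)^(r-1) = p0 p1^(r-1). *)
Definition p0 (R : realType) (r : nat) (rho : R) : R :=
  rho ^+ r.-1 / (1 + rho ^+ r.-1).

Definition p1 (R : realType) (rho : R) : R := 1 / (1 + rho).

Definition winA (R : realType) : R := 1 / 2.

Definition winB (R : realType) (r : nat) (rho : R) (x : int) : R :=
  if (r%:Z %| x)%Z then p0 r rho else p1 rho.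

(* The game played at a turn is drawn independently of the past (A with
   probability gamma), so one turn of the mixture started from capital x is won
   with the averaged probability. *)
Definition win_mix (R : realType) (r : nat) (rho gamma : R) (x : int) : R :=
  gamma * winA R + (1 - gamma) * winB r rho x.

Definition step_prob (R : realType) (r : nat) (rho gamma : R) (x y : int) : R :=
  if y == x + 1 then win_mix r rho gamma x
  else if y == x - 1 then 1 - win_mix r rho gamma x
  else 0.

(* The event that X follows the path s up to and including time n. *)
Definition follows (T : Type) (X : nat -> T -> int) (s : nat -> int) (n : nat) :
    set T :=
  [set w | forall k : nat, (k <= n)%N -> X k w = s k].

(* The Markov property is stated in product form, which agrees with the
   conditional form on histories of positive probability and is automatic on
   null ones. *)
Definition capital_process (R : realType) (d : measure_display)
    (T : measurableType d) (P : probability T R)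
    (r : nat) (rho gamma : R) (x0 : int) (X : nat -> T -> int) : Prop :=
  [/\ forall (n : nat) (x : int), measurable (X n @^-1` [set x]),
      P (X 0%N @^-1` [set x0]) = 1%:E
    & forall (s : nat -> int) (n : nat),
        P (follows X s n.+1) =
        (P (follows X s n) * (step_prob r rho gamma (s n) (s n.+1))%:E)%E].

Definition profit (T : Type) (X : nat -> T -> int) (n : nat) (w : T) : int :=
  X n w - X 0%N w.

(* One constant m must serve for every initial capital and every realization of
   the chain. *)
Definition is_profit_rate (R : realType) (r : nat) (rho gamma m : R) : Prop :=
  forall (x0 : int) (d : measure_display) (T : measurableType d)
    (P : probability T R) (X : nat -> T -> int),
    capital_process P r rho gamma x0 X ->
    {ae P, forall w, (profit X n w)%:~R / n%:R @[n --> \oo] --> m}.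

(* "The" constant, by definite description; 0 is a dummy value, used only if no
   constant satisfies is_profit_rate. *)
Definition profit_rate (R : realType) (r : nat) (rho gamma : R) : R :=
  xget 0 [set m : R | is_profit_rate r rho gamma m].

(* Main.v *)
Require Import Defs.
From HB Require Import structures.
From mathcomp Require Import all_boot all_order all_algebra.
From mathcomp Require Import all_classical all_reals all_analysis.
From mathcomp Require Import ring lra zify.
Import Order.TTheory GRing.Theory Num.Theory.
Import numFieldNormedType.Exports.
Local Open Scope classical_set_scope.
Local Open Scope ring_scope.

(* If g - id is bounded on Z and g solves p x g(x+1) + (1 - p x) g(x-1) = g x + m,
   then g (X_n) - n m is a martingale with bounded increments, so m is the rate
   of profit: exponential moments bound P (|g (X_n) - g x0 - n m| > e n) by a
   geometric sequence, and Borel-Cantelli applies. On [0, r] such a g is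
   v x + B (th^x - 1) with th = (1 - b) / b, where a and b are the winning
   probabilities at multiples of r and elsewhere; the boundary conditions give
   m = (2 b - 1) r / (r + Q), where
   Q = 2 (b - a) (1 - th^r) / ((1 - th) (a - (1 - a) th^(r-1))). With rho = gamma = e and r >= 1 / e^2 one has
   Q <= 16 / e, hence m >= 1 - 19 e. The upper bound is |S_n| <= n, tested on a
   chain realized on [0, 1[ by successive subdivision of intervals. *)

Lemma followsS (T : Type) (X : nat -> T -> int) s n :
  follows X s n.+1 = follows X s n `&` X n.+1 @^-1` [set s n.+1].
Proof.
apply/seteqP; split => w /=; first by move=> H; split=> [k /leqW|]; exact: H.
by move=> [H HS] k; rewrite leq_eqVlt => /predU1P[->|/H].
Qed.

(** * Realization of a nearest-neighbour chain on [0, 1[ *)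

Section interval_realization.
Context {R : realType}.

(** The sample space remains the whole real line, so that its measurable structure is reused; points
    outside [0, 1[ carry no mass. *)
Definition unit_lebesgue :=
  mrestr (@lebesgue_measure R) (measurable_itv `[0, 1[).
HB.instance Definition _ := Measure.on unit_lebesgue.

Let unit_lebesgueT : unit_lebesgue setT = 1%E.
Proof.
rewrite /unit_lebesgue /mrestr setTI.
by rewrite lebesgue_measure_itv /= lte01 oppr0 adde0.
Qed.
HB.instance Definition _ :=
  Measure_isProbability.Build _ _ _ unit_lebesgue unit_lebesgueT.

Variables (p : int -> R) (x0 : int).
Hypothesis p01 : forall x, 0 <= p x <= 1.

(* A history lists the outcomes of the games, most recent first. The points of
   [0, 1[ with history h form the interval of length hlen h starting at hlow h,
   whose left part of relative length p is where the next game is won. *)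
Fixpoint hpos (h : seq bool) : int :=
  if h is b :: h' then (if b then hpos h' + 1 else hpos h' - 1) else x0.

Fixpoint hlen (h : seq bool) : R :=
  if h is b :: h' then
    hlen h' * (if b then p (hpos h') else 1 - p (hpos h'))
  else 1.

Fixpoint hlow (h : seq bool) : R :=
  if h is b :: h' then
    (if b then hlow h' else hlow h' + hlen h' * p (hpos h'))
  else 0.

Fixpoint hist (n : nat) (u : R) : seq bool :=
  if n is n'.+1 then
    let h := hist n' u in (u < hlow h + hlen h * p (hpos h)) :: h
  else [::].

Lemma hlen_ge0 h : 0 <= hlen h.
Proof.
elim: h => //= b h IH; apply: mulr_ge0 => //.
by have /andP[? ?] := p01 (hpos h); case: b; rewrite ?subr_ge0.
Qed.

Lemma hist_itv n h : size h = n ->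
  [set u | hist n u = h] `&` `[0, 1[%classic = `[hlow h, hlow h + hlen h[%classic.
Proof.
elim: n h => [[]//= _|n IH [//|b h] /= [/IH{}IH]].
  by rewrite add0r; apply/seteqP; split => u /=; tauto.
have /andP[p0 p1] := p01 (hpos h); have l0 := hlen_ge0 h.
have lp : 0 <= hlen h * p (hpos h) by exact: mulr_ge0.
have lp1 : hlen h * p (hpos h) <= hlen h by rewrite ler_piMr.
move/seteqP: IH => -[IH1 IH2]; apply/seteqP; split => u /=.
  case=> -[bu hu] u01; have := IH1 u (conj hu u01).
  rewrite hu in bu; rewrite /= !in_itv /= => /andP[lu ul].
  case: b bu => [->|/negbT]; rewrite ?lu // -leNgt => -> /=.
  by rewrite -addrA -mulrDr subrKC mulr1.
rewrite in_itv /= => ub; have := IH2 u; rewrite /= !in_itv /=.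
have -> : hlow h <= u < hlow h + hlen h.
  case: b ub; lra.
move=> /(_ isT)[hu u01]; split=> //; rewrite hu; congr cons.
case: b ub => /andP[]; first by [].
by move=> ? _; apply/negbTE; rewrite -leNgt.
Qed.

Lemma measurable_hist n h : measurable [set u | hist n u = h].
Proof.
elim: n h => [|n IH] [|b h] /=.
- by rewrite (_ : [set _ | _] = setT) //; apply/seteqP; split.
- by rewrite (_ : [set _ | _] = set0) //; apply/seteqP; split.
- by rewrite (_ : [set _ | _] = set0) //; apply/seteqP; split.
set t := hlow h + hlen h * p (hpos h).
rewrite (_ : [set _ | _] = [set u | hist n u = h] `&`
   (if b then `]-oo, t[%classic else `[t, +oo[%classic)).
  by apply: measurableI => //; case: b; exact: measurable_itv.
apply/seteqP; split => u /=.
  case=> <- hu; split=> //; rewrite hu -/t; case: ltP => /=; rewrite in_itv //=.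
  by rewrite andbT.
case=> ->; rewrite -/t; case: b; rewrite /= in_itv /= => tu; congr cons => //.
by apply/negbTE; rewrite -leNgt; case/andP: tu.
Qed.

Lemma unit_lebesgue_hist n h : size h = n ->
  unit_lebesgue [set u | hist n u = h] = (hlen h)%:E.
Proof.
move=> sh; rewrite /unit_lebesgue /mrestr hist_itv // lebesgue_measure_itv /=.
rewrite lte_fin ltrDl lt_neqAle hlen_ge0 andbT eq_sym; case: eqP => [->|_] //=.
by rewrite -EFinB addrC addKr.
Qed.

Lemma measurable_hpos n x :
  measurable ((fun u => hpos (hist n u)) @^-1` [set x]).
Proof.
rewrite (_ : _ @^-1` _ = \bigcup_(h in [set h | hpos h = x])
  [set u | hist n u = h]); last first.
  by apply/seteqP; split => u /= => [<-|[h /= <- ->]] //; exists (hist n u).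
rewrite bigcup_mkcond; apply: countable_bigcupT_measurable => // h.
by case: ifP => // _; exact: measurable_hist.
Qed.

Lemma hpos_steps n u : (`|hpos (hist n u) - x0| <= n%:Z).
Proof.
elim: n => [|n IH] /=; first by rewrite subrr.
set y := hpos _ in IH *.
by case: ifP => _; lia.
Qed.

(** A path of unit steps from [x0] determines its record of wins and losses, hence a single history.
    A wrong start or a step other than 1 or -1 makes the event empty. *)
Lemma follows_hist (s : nat -> int) n :
  let X k u := hpos (hist k u) in
  follows X s n = set0 \/
  exists h, [/\ size h = n, hpos h = s n & follows X s n = [set u | hist n u = h]].
Proof.
move=> X; elim: n => [|n IH].
  have [sx|sx] := eqVneq x0 (s 0%N).
    right; exists [::]; split=> //; apply/seteqP; split => u //= _ k.
    by rewrite leqn0 => /eqP ->.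
  by left; apply/seteqP; split=> u //= /(_ 0%N isT)/= /eqP; rewrite (negbTE sx).
rewrite followsS; case: IH => [->|[h [sh hs ->]]]; first by left; rewrite set0I.
have [su|su] := eqVneq (s n.+1) (s n + 1).
  right; exists (true :: h); split; rewrite /= ?sh ?hs //.
  apply/seteqP; split => u /=.
    case=> hu; rewrite /X /= hu hs su; case: ifP => // _ /eqP; lia.
  by case=> hT hu; rewrite /X /= hT hu su hs.
have [sd|sd] := eqVneq (s n.+1) (s n - 1).
  right; exists (false :: h); split; rewrite /= ?sh ?hs //.
  apply/seteqP; split => u /=.
    case=> hu; rewrite /X /= hu hs sd; case: ifP => // _ /eqP; lia.
  by case=> hT hu; rewrite /X /= hT hu sd hs.
left; apply/seteqP; split => u //= -[hu]; rewrite /X /= hu hs.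
by case: ifP => _ /esym/eqP; rewrite ?(negbTE su) ?(negbTE sd).
Qed.

(** Both events are history intervals or empty, and [hlen] is multiplied by the probability of the
    last outcome. *)
Lemma unit_lebesgue_follows (s : nat -> int) n :
  let X k u := hpos (hist k u) in
  unit_lebesgue (follows X s n.+1) =
  (unit_lebesgue (follows X s n) *
   (if s n.+1 == s n + 1 then p (s n)
    else if s n.+1 == s n - 1 then 1 - p (s n) else 0)%:E)%E.
Proof.
move=> X; rewrite followsS; have [->|[h [sh hs ->]]] := follows_hist s n.
  by rewrite set0I !measure0 mul0e.
rewrite (unit_lebesgue_hist _ _ sh).
have step b : s n.+1 = hpos (b :: h) ->
    [set u | hist n u = h] `&` X n.+1 @^-1` [set s n.+1] =
    [set u | hist n.+1 u = b :: h].
  move=> -> /=; apply/seteqP; split => u /=.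
    by case=> hu; rewrite /X /= hu; do 2!case: ifP; case: b => // ? /eqP; lia.
  by case=> hT hu; rewrite /X /= hT hu.
case: eqP => [su|su].
  by rewrite (step true) /= ?su ?hs // (@unit_lebesgue_hist n.+1) /= ?sh // hs.
case: eqP => [sd|sd].
  by rewrite (step false) /= ?sd ?hs // (@unit_lebesgue_hist n.+1) /= ?sh // hs.
rewrite mule0 (_ : _ `&` _ = set0) ?measure0 //.
apply/seteqP; split => u //= -[hu]; rewrite /X /= hu hs.
by case: ifP => _ /esym.
Qed.

End interval_realization.

(** * Existence of a capital process *)

Section existence.
Context {R : realType}.
Variables (r : nat) (rho gamma : R).
Hypotheses (rho01 : 0 < rho < 1) (gamma01 : 0 < gamma < 1).

Lemma win_mix_itv x : 0 <= win_mix r rho gamma x <= 1.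
Proof.
have /andP[g0 g1] := gamma01; have /andP[rho0 rho1] := rho01.
have d (z : R) : 0 <= z -> 0 <= z / (1 + z) <= 1.
  move=> z0; have z1 : 0 < 1 + z by lra.
  by rewrite divr_ge0 ?(ltW z1) //= ler_pdivrMr //; lra.
have B : 0 <= winB r rho x <= 1.
  rewrite /winB /p0 /p1; case: ifP => _; first by rewrite d // exprn_ge0 // ltW.
  have z1 : 0 < 1 + rho by lra.
  by rewrite divr_ge0 ?(ltW z1) //= ler_pdivrMr //; lra.
rewrite /win_mix /winA; nra.
Qed.

(** This keeps [is_profit_rate] from holding vacuously: uniqueness of the rate and the upper bound 1
    are both tested on this process. *)
Lemma capital_process_exists :
  exists (d : measure_display) (T : measurableType d) (P : probability T R)
    (X : nat -> T -> int),
  capital_process P r rho gamma 0 X /\ forall n w, `|profit X n w| <= n%:Z.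
Proof.
pose p := win_mix r rho gamma.
exists _, _, (unit_lebesgue : probability _ R), (fun n u => hpos 0 (hist p 0 n u)).
split; last by move=> n w; rewrite /profit /=; exact: hpos_steps.
split.
- move=> n x; apply: measurable_hpos.
- by rewrite (_ : _ @^-1` _ = setT) ?probability_setT //; apply/seteqP; split.
- by move=> s n; apply: (unit_lebesgue_follows p 0 _ s n) => x; exact: win_mix_itv.
Qed.

End existence.

(** * Exponential moments of bounded martingale increments *)

Section exponential_moment.
Context {R : realType}.

(** Since 1 - x <= exp (- x), exp x <= 1 / (1 - x); and (1 - x) (1 + x + 2 x^2) = 1 + x^2 (1 - 2 x)
    >= 1. *)
Lemma expR_le_quad (x : R) : `|x| <= 1 / 2 -> expR x <= 1 + x + 2 * x ^+ 2.
Proof.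
rewrite ler_norml => /andP[x1 x2].
have e0 : 0 < 1 - x by lra.
have : (1 - x) * expR x <= 1.
  rewrite -[leRHS](expRxMexpNx_1 x) mulrC ler_pM2l ?expR_gt0 //.
  exact: expR_ge1Dx.
rewrite -ler_pdivlMl // => /le_trans; apply.
rewrite mulr1 -div1r ler_pdivrMr //.
have : 0 <= x ^+ 2 * (1 - 2 * x) by apply: mulr_ge0; [exact: sqr_ge0|lra].
nra.
Qed.

(** The linear terms of the quadratic bound cancel because the mean is zero. *)
Lemma convex_expR_le (p u v K : R) : 0 <= p <= 1 -> p * u + (1 - p) * v = 0 ->
  `|u| <= K -> `|v| <= K -> K <= 1 / 2 ->
  p * expR u + (1 - p) * expR v <= 1 + 2 * K ^+ 2.
Proof.
move=> /andP[p0 p1] m0 uK vK K2.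
have hu := expR_le_quad u (le_trans uK K2).
have hv := expR_le_quad v (le_trans vK K2).
have sq (w : R) : `|w| <= K -> w ^+ 2 <= K ^+ 2.
  by move=> wK; rewrite -real_normK ?num_real // ler_pXn2r ?nnegrE // (le_trans _ wK).
have /(_ u uK) su := sq; have /(_ v vK) sv := sq.
have h1 : p * expR u <= p * (1 + u + 2 * K ^+ 2) by apply: ler_wpM2l => //; lra.
have h2 : (1 - p) * expR v <= (1 - p) * (1 + v + 2 * K ^+ 2).
  by apply: ler_wpM2l; lra.
apply: le_trans (lerD h1 h2) _; nra.
Qed.

Fixpoint expect (p : int -> R) (k : nat) (f : int -> R) (x : int) : R :=
  if k is k'.+1 then
    p x * expect p k' f (x + 1) + (1 - p x) * expect p k' f (x - 1)
  else f x.

(** Each step costs a factor 1 + 2 (t K)^2, by [convex_expR_le] applied to the centred increments of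
    g. The offset c will hold the threshold of a Chernoff bound. *)
Lemma expect_expR (p g : int -> R) (m K t c : R) k x :
  (forall x, 0 <= p x <= 1) ->
  (forall x, p x * g (x + 1) + (1 - p x) * g (x - 1) = g x + m) ->
  (forall x, `|g (x + 1) - g x - m| <= K) ->
  (forall x, `|g (x - 1) - g x - m| <= K) ->
  0 <= t -> t * K <= 1 / 2 ->
  expect p k (fun y => expR (t * g y + c)) x <=
  (1 + 2 * (t * K) ^+ 2) ^+ k * expR (t * g x + c + k%:R * (t * m)).
Proof.
move=> p01 hg Ku Kd t0 tK; elim: k x => [|k IH] x /=.
  by rewrite expr0 mul1r mul0r addr0.
have /andP[p0 p1] := p01 x; set q := 1 + _ in IH *.
have q0 : 0 <= q ^+ k by rewrite exprn_ge0 // /q; nra.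
set e := expR (t * g x + c + k.+1%:R * (t * m)).
have E y : expR (t * g y + c + k%:R * (t * m)) =
    e * expR (t * (g y - g x - m)).
  by rewrite /e -expRD; congr expR; rewrite -natr1; ring.
have h1 := ler_wpM2l p0 (IH (x + 1)).
have h2 : (1 - p x) * _ <= _ := ler_wpM2l _ (IH (x - 1)).
rewrite subr_ge0 in h2; move/(_ p1) in h2.
apply: le_trans (lerD h1 h2) _; rewrite !E.
have := convex_expR_le (p x) (t * (g (x + 1) - g x - m))
  (t * (g (x - 1) - g x - m)) (t * K) (p01 x).
rewrite !normrM (ger0_norm t0) !ler_wpM2l // => /(_ _ isT isT tK) H.
have {}H := H ltac:(have := hg x; nra).
rewrite exprSr.
have e0 : 0 <= q ^+ k * e by rewrite mulr_ge0 // expR_ge0.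
have := ler_wpM2l e0 H; rewrite -/q; lra.
Qed.

End exponential_moment.

(** * From the Markov property in product form to bounds on the law of [X n] *)

Section marginal.
Context {R : realType} {d : measure_display} {T : measurableType d}.
Variables (P : probability T R) (r : nat) (rho gamma : R) (x0 : int).
Variable X : nat -> T -> int.
Hypothesis cpX : capital_process P r rho gamma x0 X.
Let p := win_mix r rho gamma.

Lemma measurable_capital n (A : set int) : measurable (X n @^-1` A).
Proof.
have [mX _ _] := cpX; rewrite (_ : _ @^-1` _ =
    \bigcup_(x in A) X n @^-1` [set x]); last first.
  by apply/seteqP; split => w /= => [?|[x /= ? ->]] //; exists (X n w).
rewrite bigcup_mkcond; apply: countable_bigcupT_measurable => // x.
by case: ifP.
Qed.

Lemma measurable_follows s n : measurable (follows X s n).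
Proof.
elim: n => [|n IH].
  rewrite (_ : follows _ _ _ = X 0%N @^-1` [set s 0%N]).
    exact: measurable_capital.
  apply/seteqP; split => w /=; first by apply.
  by move=> H k; rewrite leqn0 => /eqP ->.
by rewrite followsS; apply: measurableI => //; exact: measurable_capital.
Qed.

Let pr A := fine (P A).
Let prE A : measurable A -> P A = (pr A)%:E.
Proof. by move=> mA; rewrite /pr fineK // fin_num_measure. Qed.

(** A Markov inequality, f dominating the indicator of A. Induction on k splits the event at time n
    by the next move: up, down, or a null remainder. *)
Lemma pr_follows_capital_le (f : int -> R) (A : set int) s n k :
  (forall y, 0 <= f y) -> (forall y, A y -> 1 <= f y) ->
  pr (follows X s n `&` X (n + k)%N @^-1` A) <=
  pr (follows X s n) * expect p k f (s n).
Proof.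
move=> f0 f1.
have pr0 B : 0 <= pr B by rewrite fine_ge0.
have prle B C : measurable B -> measurable C -> B `<=` C -> pr B <= pr C.
  by move=> mB mC BC; rewrite -lee_fin -!prE // le_measure ?inE.
elim: k s n => [|k IH] s n /=.
  rewrite addn0; have [As|As] := pselect (A (s n)).
    apply: (@le_trans _ _ (pr (follows X s n))); last by rewrite ler_peMr // f1.
    apply: prle => //; [apply: measurableI|]; do ?exact: measurable_follows.
    exact: measurable_capital.
  rewrite (_ : _ `&` _ = set0); last first.
    by apply/seteqP; split => w //= -[/(_ n (leqnn n)) ->].
  by rewrite {1}/pr measure0 /= mulr_ge0.
(* The path is redirected to y after time n, so that the two moves are again [follows] events. *)
pose s' y i := if (i <= n)%N then s i else y.
have fs' y : follows X (s' y) n = follows X s n.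
  by apply/seteqP; split => w H i iln; have := H i iln; rewrite /s' iln.
have mF := measurable_follows s n; set F := follows X s n in mF fs' *.
pose U := follows X (s' (s n + 1)) n.+1.
pose D := follows X (s' (s n - 1)) n.+1.
have mU : measurable U := measurable_follows _ _.
have mD : measurable D := measurable_follows _ _.
have UE : U = F `&` X n.+1 @^-1` [set s n + 1].
  by rewrite /U followsS fs' /s' ltnn.
have DE : D = F `&` X n.+1 @^-1` [set s n - 1].
  by rewrite /D followsS fs' /s' ltnn.
have [_ _ mk] := cpX.
have PU : pr U = pr F * p (s n).
  rewrite /pr mk fs' /s' leqnn ltnn /step_prob eqxx -/p.
  by rewrite -[in LHS]/F prE //.
have PD : pr D = pr F * (1 - p (s n)).
  rewrite /pr mk fs' /s' leqnn ltnn /step_prob ifF ?eqxx; last by apply/negbTE; lia.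
  by rewrite -[in LHS]/F prE //.
have UD : U `&` D = set0.
  by rewrite UE DE; apply/seteqP; split => w //= -[[_ ->] [_ /eqP]]; lia.
pose N := F `\` (U `|` D).
have mN : measurable N by apply: measurableD => //; exact: measurableU.
(* The two moves already exhaust the mass of F, as their probabilities sum to 1. *)
have PN : pr N = 0.
  have FUD : F `&` (U `|` D) = U `|` D by rewrite setIUr UE DE !setIA setIid.
  have PFE : P F = (P N + (P U + P D))%E.
    rewrite (measureDI P mF (measurableU _ _ mU mD)) FUD.
    by congr (_ + _)%E; rewrite measureU.
  by move: PFE; rewrite !prE // -!EFinD PU PD => -[]; lra.
set B := X _ @^-1` A; have mB : measurable B by exact: measurable_capital.
have IHU := IH (s' (s n + 1)) n.+1; have IHD := IH (s' (s n - 1)) n.+1.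
rewrite addSnnS -/B -/U in IHU; rewrite addSnnS -/B -/D in IHD.
rewrite /s' ltnn PU in IHU; rewrite /s' ltnn PD in IHD.
have mUB : measurable (U `&` B) by exact: measurableI.
have mDB : measurable (D `&` B) by exact: measurableI.
have mFB : measurable (F `&` B) by exact: measurableI.
have : pr (F `&` B) <= pr (U `&` B) + pr (D `&` B) + pr N.
  rewrite -lee_fin !EFinD -!prE //.
  have mUD := measurableU _ _ mUB mDB.
  apply: le_trans (leeD2r _ (measureU2 P mUB mDB)).
  apply: le_trans (measureU2 P mUD mN).
  apply: le_measure; rewrite ?inE //; first exact: measurableU.
  move=> w [Fw Bw]; rewrite /N /=; have [|] := pselect (U w \/ D w); tauto.
rewrite PN; lra.
Qed.

Lemma capital_prob_le (f : int -> R) (A : set int) n :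
  (forall y, 0 <= f y) -> (forall y, A y -> 1 <= f y) ->
  (P (X n @^-1` A) <= (expect p n f x0)%:E)%E.
Proof.
move=> f0 f1; have [mX X0 _] := cpX.
have F0 : follows X (fun=> x0) 0 = X 0%N @^-1` [set x0].
  apply/seteqP; split => w /=; first by apply.
  by move=> H k; rewrite leqn0 => /eqP ->.
have := pr_follows_capital_le f A (fun=> x0) 0 n f0 f1.
rewrite F0 add0n {2}/pr X0 mul1r -lee_fin -prE; last first.
  by apply: measurableI => //; exact: measurable_capital.
(* The start differs from [x0] only on a null event, which is split off. *)
apply: le_trans; rewrite -{1}(setIT (X n @^-1` A)) -(setUv (X 0%N @^-1` [set x0])).
have mC := measurableC (mX 0%N x0).
rewrite setIUr setIC measureU0 //.
- by apply: measurableI => //; exact: measurable_capital.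
- by apply: measurableI => //; exact: measurable_capital.
apply/eqP; rewrite eq_le measure_ge0 andbT.
apply: (@le_trans _ _ (P (~` (X 0%N @^-1` [set x0])))).
  apply: le_measure; rewrite ?inE //.
  by apply: measurableI => //; exact: measurable_capital.
by rewrite probability_setC // X0 subee.
Qed.

End marginal.

(** * Chernoff bound, Borel-Cantelli and the almost sure rate *)

Section deviation.
Context {R : realType} {d : measure_display} {T : measurableType d}.
Variables (P : probability T R) (r : nat) (rho gamma : R) (x0 : int).
Variable X : nat -> T -> int.
Hypothesis cpX : capital_process P r rho gamma x0 X.
Let p := win_mix r rho gamma.
Hypothesis p01 : forall x, 0 <= p x <= 1.

Lemma ae_eventually_le (g : int -> R) (m K e : R) :
  (forall x, p x * g (x + 1) + (1 - p x) * g (x - 1) = g x + m) ->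
  (forall x, `|g (x + 1) - g x - m| <= K) ->
  (forall x, `|g (x - 1) - g x - m| <= K) ->
  0 < e ->
  {ae P, forall w, exists N : nat, forall n, (N <= n)%N ->
     g (X n w) - g x0 - n%:R * m <= n%:R * e}.
Proof.
move=> hg Ku Kd e0.
have K0 : 0 <= K := le_trans (normr_ge0 _) (Ku 0).
(* For small t the quadratic cost 2 (t K)^2 is below t e, and 1 + t e <= exp (t e). The chosen t
   gives both t K <= 1 / 2 and 2 t K^2 < e. *)
have [t [t0 tK te]] : exists t, [/\ 0 < t, t * K <= 1 / 2 &
    (1 + 2 * (t * K) ^+ 2) * expR (- (t * e)) < 1].
  have D0 : 0 < 2 * K + 2 * K ^+ 2 / e + 1.
    have : 0 <= 2 * K ^+ 2 / e by rewrite divr_ge0 ?(ltW e0) // mulr_ge0 ?sqr_ge0.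
    lra.
  pose t := (2 * K + 2 * K ^+ 2 / e + 1)^-1.
  have t0 : 0 < t by rewrite invr_gt0.
  have tD : t * (2 * K + 2 * K ^+ 2 / e + 1) = 1 by rewrite mulVf // gt_eqF.
  have a0 : 0 <= t * (2 * K ^+ 2 / e).
    by rewrite mulr_ge0 ?(ltW t0) // divr_ge0 ?(ltW e0) // mulr_ge0 ?sqr_ge0.
  have b0 : 0 <= t * K by rewrite mulr_ge0 ?(ltW t0).
  exists t; split => //; first lra.
  have a1 : t * (2 * K ^+ 2 / e) < 1 by lra.
  have a2 : t * (2 * K ^+ 2) < e by rewrite -[ltRHS]mul1r -ltr_pdivrMr // -mulrA.
  have a3 : t * (t * (2 * K ^+ 2)) < t * e by rewrite ltr_pM2l.
  rewrite expRN ltr_pdivrMr ?expR_gt0 // mul1r.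
  apply: lt_le_trans (expR_ge1Dx _); rewrite exprMn; lra.
set q := (_ * _) in te; have q0 : 0 <= q.
  by rewrite mulr_ge0 ?expR_ge0 // addr_ge0 // mulr_ge0 // sqr_ge0.
pose A n := [set y | n%:R * e < g y - g x0 - n%:R * m].
pose F n := X n @^-1` A n.
have mF n : measurable (F n) by exact: (measurable_capital _ _ _ _ _ _ cpX).
have PF n : (P (F n) <= (q ^+ n)%:E)%E.
  (* With this offset the exponent is nonnegative on [A n], so the exponential dominates the
     indicator. *)
  pose c := - (t * (g x0 + n%:R * m + n%:R * e)).
  apply: le_trans (capital_prob_le _ _ _ _ _ _ cpX
    (fun y => expR (t * g y + c)) _ _ _ _) _.
  - by move=> y; exact: expR_ge0.
  - move=> y; rewrite /A /= => Ay; rewrite -expR0 ler_expR /c.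
    have -> : t * g y + - (t * (g x0 + n%:R * m + n%:R * e)) =
      t * (g y - g x0 - n%:R * m - n%:R * e) by ring.
    by rewrite mulr_ge0 ?(ltW t0) //; lra.
  rewrite lee_fin.
  apply: le_trans (expect_expR p g m K t c n x0 p01 hg Ku Kd (ltW t0) tK) _.
  rewrite /q [leRHS]exprMn -expRM_natl ler_wpM2l //.
    by rewrite exprn_ge0 // addr_ge0 // mulr_ge0 // sqr_ge0.
  by rewrite ler_expR /c; lra.
have q1 : 0 < 1 - q by lra.
have sumF : (\sum_(n <oo) P (F n) < +oo)%E.
  apply: (@le_lt_trans _ _ ((1 - q)^-1)%:E); last exact: ltry.
  apply: lime_le; first by apply: is_cvg_nneseries.
  apply: nearW => n; apply: (@le_trans _ _ (\sum_(0 <= i < n) (q ^+ i)%:E)%E).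
    by apply: lee_sum.
  rewrite sumEFin lee_fin big_mkord -[leRHS]mulr1 ler_pdivlMl //.
  rewrite -opprB mulNr -subrX1 opprB lerBlDr lerDl.
  exact: exprn_ge0.
(* Outside the limit superior only finitely many bad events occur. *)
exists (lim_sup_set F); split.
- by apply: bigcapT_measurable => n; apply: bigcup_measurable.
- exact: lim_sup_set_cvg0.
move=> w /= Hw n _; apply: contrapT => Hn; apply: Hw; exists n => k nk.
rewrite leNgt; apply/negP => lt; apply: Hn; exists k => //.
Qed.

End deviation.

(** The bound H serves twice: it bounds the martingale increments by K, and it replaces g (X_n) - g
    x0 by the profit at a cost 2 H, negligible after division by n. *)
Lemma is_profit_rateI {R : realType} (r : nat) (rho gamma m H : R) (g : int -> R) :
  let p := win_mix r rho gamma in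
  (forall x, 0 <= p x <= 1) ->
  (forall x, p x * g (x + 1) + (1 - p x) * g (x - 1) = g x + m) ->
  (forall x, `|g x - x%:~R| <= H) ->
  is_profit_rate r rho gamma m.
Proof.
move=> p p01 hg gH x0 d T P X cpX.
have H0 : 0 <= H := le_trans (normr_ge0 _) (gH 0).
pose K := 1 + 2 * H + `|m|.
have m1 := ler_norm m; have m2 := ler_norm (- m); rewrite normrN in m2.
have Ku x : `|g (x + 1) - g x - m| <= K.
  have := gH x; have := gH (x + 1); rewrite intrD /K.
  rewrite !ler_norml => /andP[? ?] /andP[? ?]; apply/andP; split; lra.
have Kd x : `|g (x - 1) - g x - m| <= K.
  have := gH x; have := gH (x - 1); rewrite intrB /K.
  rewrite !ler_norml => /andP[? ?] /andP[? ?]; apply/andP; split; lra.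
have e0 k : 0 < k.+1%:R^-1 :> R by rewrite invr_gt0.
have [_ X0 _] := cpX.
have aeX0 : {ae P, forall w, X 0%N w = x0}.
  have mX0 : measurable (X 0%N @^-1` [set x0]) by case: cpX.
  exists (~` (X 0%N @^-1` [set x0])); split.
  - exact: measurableC.
  - by rewrite probability_setC // X0 subee.
  - by move=> w.
(* Tolerances 1 / (k + 1) keep the intersection of almost sure events countable. *)
have up : {ae P, forall w, forall k : nat, exists N : nat, forall n, (N <= n)%N ->
     g (X n w) - g x0 - n%:R * m <= n%:R / k.+1%:R}.
  apply: ae_foralln => k.
  exact: (ae_eventually_le _ _ _ _ _ _ cpX p01 g m K _ hg Ku Kd (e0 k)).
(* Lower deviations are upper deviations for - g, whose drift is - m. *)
have dn : {ae P, forall w, forall k : nat, exists N : nat, forall n, (N <= n)%N ->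
     - g (X n w) - - g x0 - n%:R * - m <= n%:R / k.+1%:R}.
  apply: ae_foralln => k.
  apply: (ae_eventually_le _ _ _ _ _ _ cpX p01 (fun y => - g y) (- m) K _ _ _ _ (e0 k)).
  - by move=> x; have := hg x; rewrite -/p; lra.
  - move=> x; have -> : - g (x + 1) - - g x - - m = - (g (x + 1) - g x - m) by ring.
    by rewrite normrN.
  - move=> x; have -> : - g (x - 1) - - g x - - m = - (g (x - 1) - g x - m) by ring.
    by rewrite normrN.
move: up dn aeX0; apply: filterS3 => w up dn X0w.
apply/cvgrPdist_le => /= e epos.
(* Half of e absorbs the deviation; the other half absorbs 2 H / n once n >= N3. *)
have [k ke] : exists k : nat, k.+1%:R^-1 <= e / 2 :> R.
  exists (Num.truncn (2 / e)).
  rewrite -[e / 2]invrK lef_pV2 ?posrE ?invr_gt0 ?divr_gt0 // invf_div.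
  by apply/ltW/truncnS_gt.
have [N1 up1] := up k; have [N2 dn2] := dn k.
have [N3 hN3] : exists N3 : nat, 2 * H / (e / 2) <= N3%:R.
  by exists (Num.truncn (2 * H / (e / 2))).+1; apply/ltW/truncnS_gt.
near=> n.
have n0 : 0 < n%:R :> R by rewrite ltr0n; near: n; exact: nbhs_infty_gt.
have n1 : (N1 <= n)%N by near: n; exact: nbhs_infty_ge.
have n2 : (N2 <= n)%N by near: n; exact: nbhs_infty_ge.
have n3 : (N3 <= n)%N by near: n; exact: nbhs_infty_ge.
have h3 : 2 * H <= n%:R * (e / 2).
  rewrite -ler_pdivrMr ?divr_gt0 //; apply: le_trans hN3 _.
  by rewrite ler_nat.
have h4 : n%:R * k.+1%:R^-1 <= n%:R * (e / 2) :> R by rewrite ler_wpM2l // ltW.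
rewrite /profit X0w.
have -> : m - (X n w - x0)%:~R / n%:R = (n%:R * m - (X n w - x0)%:~R) / n%:R.
  by field; rewrite gt_eqF.
rewrite normrM normfV (gtr0_norm n0) ler_pdivrMr // intrB.
have := gH (X n w); have := gH x0; have := le_trans (up1 n n1) h4;
  have := le_trans (dn2 n n2) h4.
rewrite !ler_norml => ? ? /andP[? ?] /andP[? ?]; apply/andP; split; lra.
Unshelve. all: by end_near.
Qed.

(** * Extension of the harmonic function from [0, r] to Z *)

Section periodic_lift.
Context {R : realType}.
Variables (r : nat) (G : nat -> R).
Hypotheses (r0 : (0 < r)%N) (G0 : G 0%N = 0) (Gr : G r = r%:R).

Definition periodic_lift (x : int) : R :=
  r%:R * (x %/ r)%Z%:~R + G `|(x %% r)%Z|%N.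

(** The case k = r, where [Gr] joins consecutive periods, covers the right neighbour of the residue
    r - 1. *)
Lemma periodic_liftE (q : int) (k : nat) : (k <= r)%N ->
  periodic_lift (q * r + k) = r%:R * q%:~R + G k.
Proof.
have rn0 : r%:Z != 0 by lia.
rewrite /periodic_lift leq_eqVlt => /predU1P[->|kr].
  rewrite -[X in q * _ + X]mul1r -mulrDl mulzK // modzMl /= G0 Gr intrD.
  by rewrite mulrDr mulr1 addr0.
rewrite divzMDl // modzMDl divz_small ?modz_small ?addr0 //=.
all: by rewrite ?ltz_nat ?abszE //; lia.
Qed.

Lemma int_residue (x : int) : exists (q : int) (k : nat), x = q * r + k /\ (k < r)%N.
Proof.
have rn0 : r%:Z != 0 by lia.
exists (x %/ r)%Z, `|(x %% r)%Z|%N; have := divz_eq x r.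
have := modz_ge0 x rn0; have := ltz_mod x rn0; lia.
Qed.

Lemma periodic_lift_near_id (x : int) :
  `|periodic_lift x - x%:~R| <= \sum_(k < r) `|G k - k%:R|.
Proof.
have [q [k [-> kr]]] := int_residue x.
rewrite periodic_liftE 1?ltnW // intrD intrM.
rewrite (_ : _ - _ = G k - k%:R); last by rewrite -!pmulrn; ring.
rewrite (bigD1 (Ordinal kr)) //= lerDl.
by apply: sumr_ge0 => i _.
Qed.

Lemma periodic_lift_harmonic (p : int -> R) (a b m : R) :
  (forall x, p x = if (r%:Z %| x)%Z then a else b) ->
  (forall k, (k.+1 < r)%N -> b * G k.+2 + (1 - b) * G k = G k.+1 + m) ->
  a * G 1%N + (1 - a) * (G r.-1 - r%:R) = m ->
  forall x, p x * periodic_lift (x + 1) + (1 - p x) * periodic_lift (x - 1) =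
            periodic_lift x + m.
Proof.
move=> pE hG h0 x; have [q [k [-> kr]]] := int_residue x.
rewrite pE dvdzE; case: k kr => [|k] kr.
  rewrite addr0 (_ : (_ %| _)%N); last by rewrite abszM dvdn_mull.
  (* The left neighbour of a multiple of r lies in the preceding period, hence the term
     [G r.-1 - r%:R]. *)
  have -> : q * r - 1 = (q - 1) * r + r.-1 :> int by lia.
  have := periodic_liftE q 0 isT; rewrite addr0 => ->.
  rewrite (periodic_liftE q 1) // periodic_liftE ?leq_pred // G0 intrB.
  by rewrite -h0; ring.
have -> : (`|r| %| `|(q * r + k.+1)%R|)%N = false.
  by apply/negbTE; rewrite -dvdzE; apply/dvdz_mod0P; rewrite modzMDl modz_small.
have -> : q * r + k.+1 + 1 = q * r + k.+2 :> int by lia.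
have -> : q * r + k.+1 - 1 = q * r + k :> int by lia.
rewrite !periodic_liftE; try lia.
by have := hG k kr; lra.
Qed.

End periodic_lift.

(** Constants and th^k solve the homogeneous recurrence off the multiples of r, and v k adds the
    drift (2 b - 1) v. The equation at multiples of r expresses B through v; then G r = r determines
    v. *)
Lemma is_profit_rate_two_bias {R : realType} (r : nat) (rho gamma a b : R) :
  let th := (1 - b) / b in
  let c := a - (1 - a) * th ^+ r.-1 in
  let Q := 2 * (b - a) * (1 - th ^+ r) / ((1 - th) * c) in
  (0 < r)%N -> 0 <= a <= 1 -> 0 < b <= 1 ->
  (forall x, win_mix r rho gamma x = if (r%:Z %| x)%Z then a else b) ->
  1 - th != 0 -> c != 0 -> r%:R + Q != 0 ->
  is_profit_rate r rho gamma ((2 * b - 1) * (r%:R / (r%:R + Q))).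
Proof.
move=> th c Q r0 a01 /andP[b0 b1] pE th1 c0 rQ0.
pose v := r%:R / (r%:R + Q).
pose B := - (2 * (b - a) * v / ((1 - th) * c)).
pose G k := v * k%:R + B * (th ^+ k - 1).
have bth : b * th = 1 - b by rewrite /th mulrC divfK // gt_eqF.
have vQ : v * r%:R + v * Q = r%:R by rewrite -mulrDr divfK.
have BQ : B * (th ^+ r - 1) = v * Q.
  by rewrite /B /Q; field; rewrite c0.
have Bc : B * (1 - th) * c = - (2 * (b - a) * v).
  by rewrite /B; field; rewrite c0.
have G0 : G 0%N = 0 by rewrite /G expr0 subrr !mulr0 addr0.
have Gr : G r = r%:R by rewrite /G BQ.
apply: (is_profit_rateI r rho gamma _ _ (periodic_lift r G)).
- by move=> x; rewrite pE; case: ifP => // _; rewrite ltW.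
- apply: (periodic_lift_harmonic r G r0 G0 Gr _ a b _ pE).
    move=> k _; rewrite /G -!natr1.
    have -> : th ^+ k.+2 = th * th * th ^+ k by rewrite !exprS mulrA.
    rewrite exprS -/v.
    have -> : b * (v * (k%:R + 1 + 1) + B * (th * th * th ^+ k - 1)) =
      b * v * (k%:R + 1 + 1) + B * (b * th * th * th ^+ k - b) by ring.
    rewrite bth.
    have : B * (b * th) * th ^+ k = B * (1 - b) * th ^+ k by rewrite bth.
    lra.
  have -> : G r.-1 - r%:R = - v + B * (th ^+ r.-1 * (1 - th)).
    have rE : r%:R = r.-1%:R + 1 :> R by rewrite natr1 prednK.
    have tE : th ^+ r = th * th ^+ r.-1 by rewrite -exprS prednK.
    by rewrite -Gr /G rE tE; ring.
  rewrite /G expr1 -/v.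
  have := Bc; rewrite /c; set z := th ^+ r.-1; lra.
- exact: periodic_lift_near_id.
Qed.

(** * Uniqueness of the rate, its upper bound and its lower bound *)

Section bounds.
Context {R : realType}.

Lemma ae_ex {d : measure_display} {T : measurableType d} (P : probability T R)
  (Q : T -> Prop) : {ae P, forall w, Q w} -> exists w, Q w.
Proof.
move=> [A [mA A0 sA]]; apply: contrapT => nQ.
have : P setT = 0%E.
  rewrite -A0; congr (P _); apply/seteqP; split => // w _.
  by apply: sA => Qw; apply: nQ; exists w.
by rewrite probability_setT => -[] /eqP; rewrite oner_eq0.
Qed.

Lemma is_profit_rate_unique (r : nat) (rho gamma m m' : R) :
  0 < rho < 1 -> 0 < gamma < 1 ->
  is_profit_rate r rho gamma m -> is_profit_rate r rho gamma m' -> m = m'.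
Proof.
move=> rho01 gamma01 hm hm'.
have [d [T [P [X [cpX _]]]]] := capital_process_exists r rho gamma rho01 gamma01.
have [w [cm cm']] := ae_ex P _ (filterI (hm _ _ _ _ _ cpX) (hm' _ _ _ _ _ cpX)).
exact: cvg_unique cm cm'.
Qed.

Lemma is_profit_rate_le1 (r : nat) (rho gamma m : R) :
  0 < rho < 1 -> 0 < gamma < 1 -> is_profit_rate r rho gamma m -> m <= 1.
Proof.
move=> rho01 gamma01 hm.
have [d [T [P [X [cpX X1]]]]] := capital_process_exists r rho gamma rho01 gamma01.
have [w cm] := ae_ex P _ (hm _ _ _ _ _ cpX).
rewrite -(cvg_lim _ cm) //; apply: limr_le; first by apply/cvg_ex; exists m.
near=> n.
have n0 : 0 < n%:R :> R by rewrite ltr0n; near: n; exact: nbhs_infty_gt.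
rewrite ler_pdivrMr // mul1r pmulrn ler_int.
exact: le_trans (ler_norm _) (X1 n w).
Unshelve. all: by end_near.
Qed.

Lemma profit_rate_le1 (r : nat) (rho gamma : R) :
  0 < rho < 1 -> 0 < gamma < 1 -> profit_rate r rho gamma <= 1.
Proof.
(* The dummy value 0 satisfies the bound too. *)
move=> rho01 gamma01; rewrite /profit_rate; case: xgetP => [m _ hm|_] //.
exact: is_profit_rate_le1 hm.
Qed.

(** Mixing in A with weight e lifts the winning probability at multiples of r to order e, so the
    delay Q they cause is of order 1 / e, a fraction of order e of a period r >= 1 / e^2. *)
Lemma profit_rate_ge (e : R) (r : nat) : 0 < e <= 1 / 16 -> (3 <= r)%N ->
  1 <= r%:R * e ^+ 2 -> 1 - 19 * e <= profit_rate r e e.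
Proof.
move=> /andP[e0 e16] r3 re.
have e01 : 0 < e < 1 by lra.
have r2 : (1 < r.-1)%N by lia.
have r1 : (0 < r)%N by lia.
pose a := e * (1 / 2) + (1 - e) * p0 r e.
pose b := e * (1 / 2) + (1 - e) * p1 e.
pose th := (1 - b) / b.
pose c := a - (1 - a) * th ^+ r.-1.
pose Q := 2 * (b - a) * (1 - th ^+ r) / ((1 - th) * c).
have [q0 q1] : 0 <= p0 r e /\ p0 r e <= e ^+ 2.
  have er : 0 <= e ^+ r.-1 by rewrite exprn_ge0 // ltW.
  have er1 : 0 < 1 + e ^+ r.-1 by lra.
  split; first by rewrite divr_ge0 // ltW.
  have er2 : e ^+ r.-1 <= e ^+ 2.
    by apply: ler_wiXn2l => //; lra.
  rewrite ler_pdivrMr //; have := sqr_ge0 e; nra.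
(* This absorbs the second-order terms, for instance in c >= e / 2 - 4 e^2 >= e / 4. *)
have e2 : 0 < e ^+ 2 <= e / 16 by rewrite exprn_gt0 //=; nra.
have a1 : e / 2 <= a <= e.
  by rewrite /a; apply/andP; split; nra.
have p1e : p1 e * (1 + e) = 1 by rewrite /p1 mul1r mulVf // gt_eqF //; lra.
have b1 : 1 - 3 / 2 * e <= b.
  by rewrite /b; nra.
have b2 : b <= 1.
  rewrite /b; have : 0 <= p1 e <= 1 by nra.
  nra.
have bth : b * th = 1 - b by rewrite /th mulrC divfK // gt_eqF //; lra.
have th0 : 0 <= th by rewrite divr_ge0 //; lra.
have th1 : th <= 2 * e.
  by rewrite ler_pdivrMr; nra.
have tle k : (0 < k)%N -> 0 <= th ^+ k <= 1.
  by move=> k0; rewrite exprn_ge0 //= exprn_ile1 //; lra.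
have t2 : 0 <= th ^+ r.-1 <= 4 * e ^+ 2.
  rewrite exprn_ge0 //=; apply: (@le_trans _ _ (th ^+ 2)).
    by apply: ler_wiXn2l => //; lra.
  have : 0 <= (2 * e - th) * (2 * e + th) by rewrite mulr_ge0 //; lra.
  lra.
have c4 : e / 4 <= c.
  by rewrite /c; nra.
have den0 : 0 < (1 - th) * c by rewrite mulr_gt0; lra.
have tr := tle r r1.
have Q0 : 0 <= Q by rewrite divr_ge0 ?(ltW den0) // mulr_ge0 //; lra.
(* The numerator of Q is at most 2 and its denominator at least e / 8. *)
have Q16 : Q * e <= 16.
  rewrite -ler_pdivlMr // ler_pdivrMr //.
  have d8 : e / 8 <= (1 - th) * c by nra.
  have : 2 * (b - a) * (1 - th ^+ r) <= 2 by nra.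
  have : 16 / e * (e / 8) = 2 by field; rewrite gt_eqF.
  have : 16 / e * (e / 8) <= 16 / e * ((1 - th) * c).
    by rewrite ler_wpM2l // divr_ge0 // ltW.
  lra.
have r0 : 0 < r%:R :> R by rewrite ltr0n.
have rQ : 0 < r%:R + Q by lra.
have hm : is_profit_rate r e e ((2 * b - 1) * (r%:R / (r%:R + Q))).
  apply: (is_profit_rate_two_bias r e e a b) => //.
  - lra.
  - lra.
  - by move=> x; rewrite /win_mix /winA /winB; case: ifP.
  - by apply/eqP; rewrite -/th; lra.
  - by rewrite -/th -/c; apply/eqP; lra.
  - by rewrite -/th -/c -/Q gt_eqF.
have -> : profit_rate r e e = (2 * b - 1) * (r%:R / (r%:R + Q)).
  apply: (is_profit_rate_unique r e e) => //.
  rewrite /profit_rate; case: xgetP => [m _ //|/(_ _ hm)//].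
(* It suffices that Q <= 16 e r, which follows from Q <= 16 / e and r e^2 >= 1. *)
have v16 : 1 - 16 * e <= r%:R / (r%:R + Q).
  rewrite ler_pdivlMr //.
  have : 0 <= (1 - Q * e / 16) * r%:R * e by rewrite !mulr_ge0 //; lra.
  have : 0 <= Q * e by rewrite mulr_ge0 // ltW.
  have : 0 <= Q * (r%:R * e ^+ 2 - 1) by rewrite mulr_ge0 //; lra.
  nra.
(* The constant 19 is 3 + 16; the product term 48 e^2 is nonnegative. *)
have : (1 - 3 * e) * (1 - 16 * e) <= (2 * b - 1) * (r%:R / (r%:R + Q)).
  by apply: ler_pM => //; lra.
nra.
Qed.

End bounds.

(** * The supremum *)

Theorem theorem2 (R : realType) :
  sup [set mu : R | exists (r : nat) (rho gamma : R),
         [/\ (3 <= r)%N, 0 < rho < 1, 0 < gamma < 1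
           & mu = profit_rate r rho gamma]] = 1.
Proof.
set S := [set mu | _].
have Sub : ubound S 1 by move=> _ [r [rho [gamma [_ ? ? ->]]]]; exact: profit_rate_le1.
have near1 e : 0 < e -> exists2 mu, S mu & 1 - e <= mu.
  move=> e0; pose e' := Num.min (1 / 16) (e / 19).
  have e'0 : 0 < e' by rewrite lt_min; apply/andP; split; lra.
  have e'1 : e' <= 1 / 16 by rewrite ge_min lexx.
  have e'2 : e' <= e / 19 by rewrite ge_min lexx orbT.
  (* One successor brings r above 1 / e'^2; the other two ensure r >= 3. *)
  pose r := (Num.truncn (1 / e' ^+ 2)).+3.
  exists (profit_rate r e' e').
    by exists r, e', e'; split => //; lra.
  apply: (@le_trans _ _ (1 - 19 * e')); first lra.
  apply: profit_rate_ge => //; first by rewrite e'0.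
  rewrite -ler_pdivrMr ?exprn_gt0 //.
  by apply: (le_trans (ltW (truncnS_gt _))); rewrite ler_nat leqW.
(* With [Sub], this makes [sup S] a genuine least upper bound instead of a default value. *)
have S0 : S !=set0 by have [mu Smu _] := near1 1 ltr01; exists mu.
apply/eqP; rewrite eq_le ge_sup //=; apply/ler_addgt0Pr => e e0.
have [mu Smu le] := near1 e e0; rewrite -lerBlDr (le_trans le) //.
by apply: ub_le_sup => //; exists 1.
Qed.
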